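(* Let $m,n\ge 1$. (I) Let $R=(r_1,\dots,r_m)$ and $S=(s_1,\dots,s_n)$ be vectors of nonnegative real numbers with $\sum_i r_i=\sum_j s_j$. Then $\mathcal{T}^{0}(R,S)\neq\emptyset$ if and only if (a) $R$ is palindromic, i.e. $r_i=r_{m+1-i}$ for all $i$. (II) Suppose in addition that $R$ and $S$ have nonnegative integer components. Then $\mathcal{T}^{0}_{\mathbb{Z}}(R,S)\neq\emptyset$ if and only if (a) holds and (b) if $m$ is even then every component of $S$ is even, and if $m$ is odd then $r_{\lceil m/2\rceil}\ge o(S)$, where $o(S)$ is the number of odd components of $S$.
   Context: $\mathcal{T}(R,S)$ is the set of $m\times n$ matrices with nonnegative real entries whose $i$th row sum is $r_i$ and whose $j$th column sum is $s_j$ for all $i,j$. The reflection $r_0$ (in a horizontal line) acts on $m\times n$ matrices by $(r_0 A)_{i,j}=a_{m+1-i,\,j}$. $\mathcal{T}^{0}(R,S)$ is the set of $A\in\mathcal{T}(R,S)$ with $r_0 A=A$; $\mathcal{T}^{0}_{\mathbb{Z}}(R,S)$ is the set of those $A\in\mathcal{T}^{0}(R,S)$ all of whose entries are integers. *)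

(* Defs.v *)
From mathcomp Require Import all_boot all_order all_algebra.
From mathcomp Require Import classical_sets reals.

Set Implicit Arguments.
Unset Strict Implicit.
Unset Printing Implicit Defensive.

Import Order.TTheory GRing.Theory Num.Theory.

Local Open Scope classical_set_scope.
Local Open Scope ring_scope.

Definition transport (K : realType) (m n : nat) (R : 'rV[K]_m) (S : 'rV[K]_n) :
    set 'M[K]_(m, n) :=
  [set A | [/\ forall i j, 0 <= A i j,
               forall i, \sum_(j < n) A i j = R 0 i
             & forall j, \sum_(i < m) A i j = S 0 j]].

(* Indices run over 0, ..., m-1, so the row m+1-i is [rev_ord i]. *)
Definition r0 (K : realType) (m n : nat) (A : 'M[K]_(m, n)) : 'M[K]_(m, n) :=
  \matrix_(i, j) A (rev_ord i) j.

Definition transport0 (K : realType) (m n : nat)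
    (R : 'rV[K]_m) (S : 'rV[K]_n) : set 'M[K]_(m, n) :=
  [set A | transport R S A /\ r0 A = A].

Definition transport0Z (K : realType) (m n : nat)
    (R : 'rV[K]_m) (S : 'rV[K]_n) : set 'M[K]_(m, n) :=
  [set A | transport0 R S A /\ forall i j, A i j \is a Num.int].

Definition palindromic (K : realType) (m : nat) (R : 'rV[K]_m) : Prop :=
  forall i, R 0 i = R 0 (rev_ord i).

(* Parity of a real number: non-integers are neither even nor odd; on an
   integer, [Num.floor] returns that integer as an [int]. *)
Definition even_real (K : realType) (x : K) : bool :=
  (x \is a Num.int) && (2 %| Num.floor x)%Z.

Definition odd_real (K : realType) (x : K) : bool :=
  (x \is a Num.int) && ~~ (2 %| Num.floor x)%Z.

Definition num_odd (K : realType) (n : nat) (S : 'rV[K]_n) : nat :=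
  #|[set j : 'I_n | odd_real (S 0 j)]%SET|.

(* In the odd case the 1-based index ceil(m/2) is [uphalf m]; for 0 < m exactly
   one i : 'I_m satisfies [i.+1 = uphalf m]. *)
Definition parity_condition (K : realType) (m n : nat)
    (R : 'rV[K]_m) (S : 'rV[K]_n) : Prop :=
  (~~ odd m -> forall j, even_real (S 0 j)) /\
  (odd m -> forall i : 'I_m, i.+1 = uphalf m -> (num_odd S)%:R <= R 0 i).

(* Main.v *)
(** Part (I) is witnessed by the matrix [r_i s_j / sum S]. For part (II), in a
symmetric matrix the rows distinct from the middle one cancel in pairs modulo
2, so the column sums have the parity of the middle row (or are even when there
is none). Conversely, take a nonnegative integer matrix [B] with column sums
[floor (s_j / 2)] whose row sums are [r_i] in the upper half, [0] in the lower
half and [(r_i - o(S)) / 2] in the middle: then [B + r0 B], with [s_j mod 2]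
added to the middle row, is the required matrix. *)

Require Import Defs.
From mathcomp Require Import all_boot all_order all_algebra.
From mathcomp Require Import classical_sets reals.
From mathcomp Require Import zify.

Import Order.TTheory GRing.Theory Num.Theory.

Local Open Scope classical_set_scope.
Local Open Scope ring_scope.

Section NatMatrices.
Set Implicit Arguments.
Unset Strict Implicit.
Local Open Scope nat_scope.

Lemma sum_natdelta {I : finType} (i : I) : \sum_k (k == i : nat) = 1.
Proof. by rewrite -(big_mkcond (pred1 i) (fun=> 1)) sum1_card card1. Qed.

(** Induction on the common total [k]. If [k = 0], all margins vanish and the zero matrix works.
    Otherwise some row and some column have positive margins: lower both by one, apply the induction
    hypothesis, and add one to the entry where they meet. *)
Lemma nat_transport_exists {I J : finType} (r : I -> nat) (s : J -> nat) :
  \sum_i r i = \sum_j s j ->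
  exists A : I -> J -> nat, (forall i, \sum_j A i j = r i) /\
                            (forall j, \sum_i A i j = s j).
Proof.
move def_k: (\sum_i r i) => k.
elim: k r s def_k => [|k IHk] r s sum_r sum_s.
  exists (fun _ _ => 0); split=> x; rewrite big1_eq; apply/esym/eqP.
    by move/eqP: sum_r; rewrite sum_nat_eq0 => /forallP /(_ x).
  by move/esym/eqP: sum_s; rewrite sum_nat_eq0 => /forallP /(_ x).
have ex_pos (T : finType) (f : T -> nat) : \sum_x f x = k.+1 ->
    exists2 x, 0 < f x & \sum_y (f y - (y == x)) = k.
  move=> sum_f; have [x fx_gt0] : exists x, 0 < f x.
    apply/existsP; apply: contra_eqT sum_f => /existsPn f0.
    by rewrite big1 // => x _; apply/eqP; rewrite -leqn0 leqNgt f0.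
  (* Subtraction on [nat] truncates, so splitting the sum requires [(y == x) <= f y] for every [y];
     at [y = x] this is [0 < f x]. *)
  exists x => //; rewrite sumnB ?sum_f ?sum_natdelta ?subn1 // => y _.
  by case: eqP => [->|].
have [i ri_gt0 sum_r'] := ex_pos _ r sum_r.
have [j sj_gt0 /esym sum_s'] := ex_pos _ s (esym sum_s).
have [A [rowA colA]] := IHk _ _ sum_r' sum_s'.
exists (fun x y => A x y + (x == i) * (y == j)); split=> x.
  rewrite big_split -big_distrr /= rowA sum_natdelta muln1 subnK //.
  by case: eqP => [->|].
rewrite big_split -big_distrl /= colA sum_natdelta mul1n subnK //.
by case: eqP => [->|].
Qed.

Lemma sum_rev_ord {m} (f : 'I_m -> nat) :
  \sum_i f (rev_ord i) = \sum_i f i.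
Proof. by rewrite [RHS](reindex_inj rev_ord_inj). Qed.

(** With 0-based indices, [i] is fixed exactly when [2i + 1 = m]. This links the reflection to the
    1-based middle index used in [parity_condition]. *)
Lemma rev_ord_fixed {m} (i : 'I_m) :
  (rev_ord i == i) = odd m && (i.+1 == uphalf m).
Proof.
rewrite -val_eqE /=; have := ltn_ord i; have := odd_double_half m.
by rewrite uphalf_half; case: (odd m); lia.
Qed.

Lemma sum_rev_ord_fixed {m} : \sum_(i < m) (rev_ord i == i : nat) = odd m.
Proof.
have [m_odd|m_even] := boolP (odd m); last first.
  by rewrite big1 // => i _; rewrite rev_ord_fixed (negbTE m_even).
have lt_m : (uphalf m).-1 < m by rewrite uphalf_half m_odd; lia.
rewrite -[RHS](sum_natdelta (Ordinal lt_m)); apply: eq_bigr => i _.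
rewrite rev_ord_fixed m_odd -[in RHS]val_eqE /= uphalf_half m_odd.
by rewrite add1n.
Qed.

Lemma sum_over_rev_ord_fixed {m} (f : 'I_m -> nat) i :
  rev_ord i = i -> \sum_(k < m | rev_ord k == k) f k = f i.
Proof.
move=> /eqP; rewrite rev_ord_fixed => /andP[m_odd /eqP i_mid].
by apply: big_pred1 => k; rewrite rev_ord_fixed m_odd -i_mid eqSS.
Qed.

(** The indices split into the fixed ones, the upper half and the lower half, and the reflection
    exchanges the two halves. Every parity argument below rests on this decomposition. *)
Lemma sum_rev_ord_invariant {m} (f : 'I_m -> nat) :
  (forall i, f (rev_ord i) = f i) ->
  \sum_i f i = (\sum_(i < m | i < rev_ord i) f i).*2
               + \sum_(i < m | rev_ord i == i) f i.
Proof.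
move=> f_rev; rewrite (bigID (fun i : 'I_m => rev_ord i == i)) /= addnC.
congr (_ + _); rewrite (bigID (fun i : 'I_m => i < rev_ord i)) /= -addnn.
congr (_ + _); last first.
  rewrite (reindex_inj rev_ord_inj) /=; apply: eq_big => [i|i _] //.
  by rewrite -!val_eqE /=; have := ltn_ord i; lia.
by apply: eq_bigl => i; rewrite -!val_eqE /=; have := ltn_ord i; lia.
Qed.

Lemma card_odd_sum {J : finType} (s : J -> nat) :
  #|[set j | odd (s j)]%SET| = \sum_j odd (s j).
Proof.
by rewrite -sum1_card big_mkcond; apply: eq_bigr => j _; rewrite inE; case: odd.
Qed.

Lemma nat_symmetric_parity {m} {J : finType} (A : 'I_m -> J -> nat) :
  (forall i j, A (rev_ord i) j = A i j) ->
  (~~ odd m -> forall j, ~~ odd (\sum_i A i j)) /\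
  (forall i, rev_ord i = i ->
     \sum_j odd (\sum_k A k j) <= \sum_j A i j).
Proof.
move=> A_rev; split=> [m_even j|i i_mid].
  rewrite (@sum_rev_ord_invariant _ (A^~ j)) //.
  rewrite [X in _ + X]big_pred0 ?addn0 ?odd_double //.
  by move=> i; rewrite rev_ord_fixed (negbTE m_even).
apply: leq_sum => j _; rewrite (@sum_rev_ord_invariant _ (A^~ j)) //.
rewrite (sum_over_rev_ord_fixed _ i_mid).
(* Modulo 2 only the middle entry of the column survives, and the parity bit of a natural number is
   at most that number. *)
by rewrite oddD odd_double /=; case: (A i j) => [|a] //=; case: odd.
Qed.

Lemma nat_symmetric_transport_exists {m} {J : finType}
    (r : 'I_m -> nat) (s : J -> nat) :
  \sum_i r i = \sum_j s j -> (forall i, r (rev_ord i) = r i) ->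
  (~~ odd m -> forall j, ~~ odd (s j)) ->
  (forall i, rev_ord i = i -> \sum_j odd (s j) <= r i) ->
  exists A : 'I_m -> J -> nat,
    [/\ forall i, \sum_j A i j = r i, forall j, \sum_i A i j = s j
      & forall i j, A (rev_ord i) j = A i j].
Proof.
move=> sum_rs r_rev s_even o_le.
set o := \sum_j _ in o_le.
have sum_s : \sum_j s j = o + (\sum_j (s j)./2).*2.
  rewrite -muln2 big_distrl -big_split /=; apply: eq_bigr => j _.
  by rewrite muln2 odd_double_half.
(* Comparing the two totals modulo 2 gives this congruence; it makes the halving of [r i - o]
   exact. *)
have mid_odd i : rev_ord i = i -> odd (r i) = odd o.
  move=> i_mid; have := congr1 odd sum_rs.
  rewrite (sum_rev_ord_invariant r_rev) sum_s !oddD !odd_double /= addbF.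
  by rewrite (sum_over_rev_ord_fixed _ i_mid).
(* Row sums for the matrix [B]. Adding the reflection of [B] doubles its middle row, hence the half
   there; each other pair of rows places its whole common sum in the upper row. *)
pose w (i : 'I_m) :=
  if rev_ord i == i then (r i - o)./2 else if i < rev_ord i then r i else 0.
have w_rev i : w i + w (rev_ord i) + (rev_ord i == i) * o = r i.
  rewrite /w rev_ordK [i == _]eq_sym; case: eqP => [i_mid|/eqP].
    rewrite i_mid addnn mul1n halfK oddB ?o_le // mid_odd // addbb subn0.
    by rewrite subnK ?o_le.
  rewrite mul0n addn0 r_rev -val_eqE neq_ltn orbC => /orP[] lt_i.
    by rewrite lt_i ltnNge (ltnW lt_i) addn0.
  by rewrite lt_i ltnNge (ltnW lt_i).
have o_even : ~~ odd m -> o = 0.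
  by move=> m_even; apply: big1 => j _; rewrite (negbTE (s_even _ _)).
have sum_w : \sum_i w i = \sum_j (s j)./2.
  (* Summing [w_rev] over all rows counts [w] twice, and counts [o] once if there is a middle row.
     If there is none, [o = 0]; so in both cases [o] cancels against the one in [sum_s], and halving
     balances the margins of [B]. *)
  have : \sum_i r i = (\sum_i w i).*2 + odd m * o.
    under eq_bigr do rewrite -w_rev.
    rewrite !big_split -big_distrl /= sum_rev_ord_fixed -addnn.
    by rewrite sum_rev_ord.
  rewrite sum_rs sum_s addnC; case: (boolP (odd m)) => [_|/o_even ->].
    by rewrite mul1n => /addIn /double_inj.
  by rewrite muln0 => /addIn /double_inj.
have [B [rowB colB]] := nat_transport_exists sum_w.
exists (fun i j => B i j + B (rev_ord i) j + (rev_ord i == i) * odd (s j)).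
split=> [i|j|i j].
- by rewrite !big_split -big_distrr /= !rowB w_rev.
- rewrite !big_split -big_distrl /= sum_rev_ord_fixed.
  rewrite (sum_rev_ord (B^~ j)) colB addnn addnC.
  rewrite -[RHS]odd_double_half; congr (_ + _).
  (* For even [m] no middle row supplies the parity bit of [s j], but that bit is then zero. *)
  by case: (boolP (odd m)) => [_|/s_even/(_ j)/negbTE ->]; rewrite ?mul1n.
- by rewrite rev_ordK [i == _]eq_sym [B (rev_ord i) j + _]addnC.
Qed.

End NatMatrices.

Section RealMatrices.
Set Implicit Arguments.
Unset Strict Implicit.
Variable K : realType.
Implicit Types (m n : nat) (x : K).

(** Truncation loses nothing on nonnegative integers, so the integral statements over [K] reduce to
    the lemmas on [nat]. *)
Lemma int_ge0_natr x : x \is a Num.int -> 0 <= x ->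
  x = (Num.truncn x)%:R.
Proof. by move=> x_int x_ge0; rewrite truncnK // -intrEge0. Qed.

Lemma even_real_natr (k : nat) : even_real (k%:R : K) = ~~ odd k.
Proof. by rewrite /even_real natr_int pmulrn intrKfloor /= dvdzE /= dvdn2. Qed.

Lemma odd_real_natr (k : nat) : odd_real (k%:R : K) = odd k.
Proof. by rewrite /odd_real natr_int pmulrn intrKfloor /= dvdzE /= dvdn2 negbK. Qed.

Lemma num_odd_natr {n} (S : 'rV[K]_n) (s : 'I_n -> nat) :
  (forall j, S 0 j = (s j)%:R) -> num_odd S = (\sum_j odd (s j))%N.
Proof.
move=> S_s; rewrite -card_odd_sum; apply: eq_card => j.
by rewrite !inE S_s odd_real_natr.
Qed.

Lemma transport0_palindromic {m n} (R : 'rV[K]_m) (S : 'rV[K]_n) A :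
  transport0 R S A -> palindromic R.
Proof.
case=> -[_ rowA _] A_rev i; rewrite -!rowA -{1}A_rev.
by apply: eq_bigr => j _; rewrite mxE.
Qed.

Lemma transport0_nonempty {m n} (R : 'rV[K]_m) (S : 'rV[K]_n) :
  (forall i, 0 <= R 0 i) -> (forall j, 0 <= S 0 j) ->
  \sum_i R 0 i = \sum_j S 0 j -> palindromic R -> transport0 R S !=set0.
Proof.
move=> R_ge0 S_ge0 sum_RS R_pal; pose t := \sum_j S 0 j.
(* When [t = 0] the division yields 0, and so do all margins. *)
have divt k (V : 'rV[K]_k) : (forall i, 0 <= V 0 i) -> \sum_i V 0 i = t ->
    forall i, V 0 i * t / t = V 0 i.
  move=> V_ge0 sum_V i; have [t0|/mulfK -> //] := eqVneq t 0.
  rewrite t0 mulr0 mul0r; apply/esym/eqP.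
  move/eqP: sum_V; rewrite t0 psumr_eq0 => [/allP /(_ i)|k' _ //].
  by rewrite mem_index_enum => /(_ isT).
exists (\matrix_(i, j) (R 0 i * S 0 j / t)); split; last first.
  by apply/matrixP => i j; rewrite !mxE -R_pal.
split=> [i j|i|j].
- by rewrite mxE !mulr_ge0 ?invr_ge0 ?sumr_ge0.
- under eq_bigr do rewrite mxE.
  by rewrite -mulr_suml -mulr_sumr divt.
- under eq_bigr do rewrite mxE.
  by rewrite -!mulr_suml sum_RS [_ * S 0 j]mulrC divt.
Qed.

Lemma transport0Z_parity {m n} (R : 'rV[K]_m) (S : 'rV[K]_n) A :
  transport0Z R S A -> parity_condition R S.
Proof.
case=> -[[A_ge0 rowA colA] A_rev] A_int.
pose a i j := Num.truncn (A i j).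
have A_a i j : A i j = (a i j)%:R by apply: int_ge0_natr.
have a_rev i j : a (rev_ord i) j = a i j by rewrite /a -{2}A_rev mxE.
have S_a j : S 0 j = (\sum_i a i j)%:R.
  by rewrite -colA natr_sum; apply: eq_bigr.
have [a_even a_mid] := nat_symmetric_parity a_rev.
split=> [m_even j|m_odd i i_mid]; first by rewrite S_a even_real_natr a_even.
rewrite (num_odd_natr S_a) -rowA; under [leRHS]eq_bigr do rewrite A_a.
rewrite -natr_sum ler_nat a_mid //.
by apply/eqP; rewrite rev_ord_fixed m_odd i_mid /=.
Qed.

Lemma transport0Z_nonempty {m n} (R : 'rV[K]_m) (S : 'rV[K]_n) :
  (forall i, 0 <= R 0 i) -> (forall j, 0 <= S 0 j) ->
  \sum_i R 0 i = \sum_j S 0 j ->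
  (forall i, R 0 i \is a Num.int) -> (forall j, S 0 j \is a Num.int) ->
  palindromic R -> parity_condition R S -> transport0Z R S !=set0.
Proof.
move=> R_ge0 S_ge0 sum_RS R_int S_int R_pal [S_even R_mid].
pose r i := Num.truncn (R 0 i); pose s j := Num.truncn (S 0 j).
have R_r i : R 0 i = (r i)%:R by apply: int_ge0_natr.
have S_s j : S 0 j = (s j)%:R by apply: int_ge0_natr.
have [||||A [rowA colA A_rev]] := @nat_symmetric_transport_exists m 'I_n r s.
(* The balance of the totals is pulled back along the injective embedding of [nat] into [K]. *)
- apply/eqP; rewrite -(eqr_nat K) !natr_sum.
  under eq_bigr do rewrite -R_r.
  by under [eqbRHS]eq_bigr do rewrite -S_s; rewrite sum_RS.
- by move=> i; rewrite /r -R_pal.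
- by move=> m_even j; rewrite -even_real_natr -S_s S_even.
- move=> i /eqP; rewrite rev_ord_fixed => /andP[m_odd /eqP i_mid].
  by rewrite -(num_odd_natr S_s) -(ler_nat K) -R_r R_mid.
exists (\matrix_(i, j) (A i j)%:R); split; last first.
  by move=> i j; rewrite mxE natr_int.
split; last by apply/matrixP => i j; rewrite !mxE A_rev.
split=> [i j|i|j].
- by rewrite mxE.
- by under eq_bigr do rewrite mxE; rewrite -natr_sum rowA R_r.
- by under eq_bigr do rewrite mxE; rewrite -natr_sum colA S_s.
Qed.

End RealMatrices.

Theorem theorem10 (K : realType) (m n : nat) (hm : (0 < m)%N) (hn : (0 < n)%N)
    (R : 'rV[K]_m) (S : 'rV[K]_n)
    (hR : forall i, 0 <= R 0 i) (hS : forall j, 0 <= S 0 j)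
    (hRS : \sum_(i < m) R 0 i = \sum_(j < n) S 0 j) :
  (transport0 R S !=set0 <-> palindromic R) /\
  ((forall i, R 0 i \is a Num.int) -> (forall j, S 0 j \is a Num.int) ->
   (transport0Z R S !=set0 <-> palindromic R /\ parity_condition R S)).
Proof.
split.
  split; last exact: transport0_nonempty.
  by case=> A; apply: transport0_palindromic.
move=> R_int S_int; split=> [[A symA]|[R_pal RS_parity]].
  split; last exact: transport0Z_parity symA.
  exact: transport0_palindromic (proj1 symA).
exact: transport0Z_nonempty.
Qed.
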